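(* Let $T\subseteq\Pi_n$ be a lower set and let $X_i$, $1\le i\le n$, be sets with $|X_i|\geq n$. Then the following two properties are equivalent: (a) $T$ is invariant under the symmetric group: if $\pi=(F_1,\dots,F_\ell)\in T$, then $\tau(\pi)=(\tau(F_1),\dots,\tau(F_\ell))\in T$ for every bijection $\tau:\{1,\dots,n\}\to\{1,\dots,n\}$. (b) For every bijection $\tau:\{1,\dots,n\}\to\{1,\dots,n\}$ and every probability measure $P\in\mathcal{M}(\mathbb{X}_n)$, $T[P^\tau]=(T[P])^\tau$.
   Context: $\Pi_n$ denotes the set of all partitions of $\{1,\dots,n\}$ into nonempty disjoint blocks, ordered by refinement: $\pi\le\sigma$ iff every block of $\pi$ is contained in a block of $\sigma$. $\hat{\mathbf{0}}_n$ is the partition into singletons and $\hat{\mathbf{1}}_n$ the one-block partition. A subset $T\subseteq\Pi_n$ is called a lower set if it contains $\hat{\mathbf 0}_n$ and $\hat{\mathbf 1}_n$ and, for every $w\in T\setminus\{\hat{\mathbf 1}_n\}$ and $z\in\Pi_n$ with $z\le w$, one has $z\in T$. Such $T$ carries the induced order, and $\mu$ denotes the M\''obius function of the poset $T$: $\mu(x,x)=1$, $\mu(x,y)=-\sum_{z\in T,\,x\le z<y}\mu(x,z)$ for $x<y$ in $T$, and $\mu(x,y)=0$ otherwise. For sets $Y_1,\dots,Y_n$, $\mathcal{M}(Y_1\times\cdots\times Y_n)$ is the vector space of discrete signed measures (finite real linear combinations of Dirac measures). For a probability measure $P$ in it and nonempty $F\subseteq\{1,\dots,n\}$, $P_F$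 is the marginal of $P$ on $\prod_{i\in F}Y_i$; for $\pi=(F_1,\dots,F_\ell)\in\Pi_n$, $P_\pi:=P_{F_1}\times\cdots\times P_{F_\ell}$, viewed as a measure on $Y_1\times\cdots\times Y_n$; and $T[P]:=\sum_{\pi\in T}\mu(\pi,\hat{\mathbf{1}}_n)P_\pi$. This is applied both to $\mathbb{X}_n=\prod_{i=1}^nX_i$ and to $\prod_{i=1}^nX_{\tau(i)}$ (i.e. $Y_i=X_{\tau(i)}$). For a signed measure $\eta$ on $\mathbb{X}_n$ and a bijection $\tau$, $\eta^\tau$ is the signed measure on $\prod_{i=1}^nX_{\tau(i)}$ defined by $\eta^\tau\big(\prod_{i=1}^nA_{\tau(i)}\big):=\eta\big(\prod_{i=1}^nA_i\big)$ for subsets $A_j\subseteq X_j$. *)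

(* Defs.v *)
From HB Require Import structures.
From mathcomp Require Import all_boot all_order all_algebra.
From mathcomp Require Import perm.

Set Implicit Arguments.
Unset Strict Implicit.
Unset Printing Implicit Defensive.

Import Order.TTheory GRing.Theory Num.Theory.

Local Open Scope ring_scope.

(* The ground set {1, ..., n} is rendered as 'I_n. *)

Definition setpart n := {set {set 'I_n}}.

Definition Pi n : {set setpart n} :=
  [set p : setpart n | partition p [set: 'I_n]].

Definition refines n (p q : setpart n) : bool :=
  [forall B in p, exists C in q, B \subset C].

Definition zero_part n : setpart n := [set [set i] | i : 'I_n].

(* For n = 0 this is not a partition, as its only block is empty; hence
   [lower_set] below has no instance for n = 0. *)
Definition one_part n : setpart n := [set [set: 'I_n]].

Definition lower_set n (T : {set setpart n}) : Prop :=
  [/\ T \subset Pi n, zero_part n \in T, one_part n \in T &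
    forall w z, w \in T -> w != one_part n -> z \in Pi n -> refines z w ->
      z \in T].

Definition perm_part n (tau : 'S_n) (p : setpart n) : setpart n :=
  [set tau @: F | F : {set 'I_n} in p].

Definition sym_invariant n (T : {set setpart n}) : Prop :=
  forall p, p \in T -> forall tau : 'S_n, perm_part tau p \in T.

Definition below n (T : {set setpart n}) (x y : setpart n) : {set setpart n} :=
  [set z in T | refines x z && (refines z y && (z != y))].

(* The recursion is on [k], which bounds the length of the chains below [y];
   [mobiusE] below is the defining recursion without the bound. *)
Fixpoint mobius_rec n (T : {set setpart n}) (k : nat) (x y : setpart n) : int :=
  if k is k'.+1 then
    if x == y then 1
    else if refines x y then - \sum_(z in below T x y) mobius_rec T k' x z
    else 0
  else 0.

Definition mobius n (T : {set setpart n}) (x y : setpart n) : int :=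
  mobius_rec T #|T| x y.

Lemma part_block n (p : setpart n) : p \in Pi n ->
  forall i, pblock p i \in p /\ i \in pblock p i.
Proof.
rewrite inE => /and3P[/eqP cov _ _] i.
by rewrite mem_pblock cov inE pblock_mem // cov inE.
Qed.

Lemma part_block_uniq n (p : setpart n) (F G : {set 'I_n}) i : p \in Pi n ->
  F \in p -> G \in p -> i \in F -> i \in G -> F = G.
Proof.
rewrite inE => /and3P[_ tr _] Fp Gp iF iG.
by rewrite -(def_pblock tr Fp iF) (def_pblock tr Gp iG).
Qed.

Section MobiusFacts.
Variables (n : nat) (T : {set setpart n}).
Hypothesis TPi : T \subset Pi n.

Lemma refinesP (p q : setpart n) :
  reflect (forall B, B \in p -> exists2 C, C \in q & B \subset C) (refines p q).
Proof.
apply: (iffP forall_inP) => h B Bp.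
  by have /exists_inP[C] := h B Bp; exists C.
by have [C Cq BC] := h B Bp; apply/exists_inP; exists C.
Qed.

Lemma refines_refl (p : setpart n) : refines p p.
Proof. by apply/refinesP => B; exists B. Qed.

Lemma refines_trans (p q r : setpart n) :
  refines p q -> refines q r -> refines p r.
Proof.
move=> /refinesP pq /refinesP qr; apply/refinesP => B /pq[C Cq BC].
by have [D Dr CD] := qr _ Cq; exists D => //; exact: subset_trans CD.
Qed.

Lemma refines_anti (p q : setpart n) : p \in Pi n -> q \in Pi n ->
  refines p q -> refines q p -> p = q.
Proof.
have sub (r s : setpart n) : r \in Pi n -> refines r s -> refines s r ->
    r \subset s.
  rewrite inE => /and3P[_ tr n0] /refinesP rs /refinesP sr.
  apply/subsetP => B Br; have [C Cs BC] := rs _ Br.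
  have [D Dr CD] := sr _ Cs.
  have /set0Pn[x xB] : B != set0 by apply: contraNneq n0 => <-.
  have BD : B = D.
    apply/eqP; apply: contraTT xB => nBD.
    have /pred0P/(_ x)/= /negbT := trivIsetP tr _ _ Br Dr nBD.
    rewrite negb_and => /orP[//|]; apply: contra.
    by move=> xB; apply: (subsetP CD); apply: (subsetP BC).
  by rewrite (_ : B = C) //; apply/eqP; rewrite eqEsubset BC BD CD.
by move=> pP qP pq qp; apply/eqP; rewrite eqEsubset !sub.
Qed.

Lemma mobius_recE k x y : x \in T -> y \in T ->
  (#|[set z in T | refines z y]| <= k)%N ->
  mobius_rec T k x y = mobius T x y.
Proof.
have main m : forall l k x y, x \in T -> y \in T ->
    (#|[set z in T | refines z y]| <= m)%N ->
    (#|[set z in T | refines z y]| <= k)%N ->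
    (#|[set z in T | refines z y]| <= l)%N ->
    mobius_rec T k x y = mobius_rec T l x y.
  elim: m => [|m IH] l {}k {}x {}y xT yT hm hk hl; have c0 :
      (0 < #|[set z in T | refines z y]|)%N;
    try by apply/card_gt0P; exists y; rewrite inE yT refines_refl.
    by have := leq_trans c0 hm.
  case: k hk => [|k hk]; first by rewrite leqNgt c0.
  case: l hl => [|l hl]; first by rewrite leqNgt c0.
  rewrite /=; case: eqP => // _; case: ifP => // _; congr (- _).
  apply: eq_bigr => z; rewrite inE => /and4P[zT xz zy nzy].
  have lt : (#|[set w in T | refines w z]| <
             #|[set w in T | refines w y]|)%N.
    apply: proper_card; apply/properP; split.
      apply/subsetP => w; rewrite !inE => /andP[-> wz] /=.
      exact: refines_trans zy.
    exists y; rewrite inE yT ?refines_refl //=; apply: contra nzy => yz; apply/eqP.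
    by apply: refines_anti => //; apply: (subsetP TPi).
  by apply: IH => //; rewrite -ltnS; apply: leq_trans lt _.
move=> xT yT hk; apply: (main #|T|) => //;
  by apply: subset_leq_card; apply/subsetP => z; rewrite inE => /andP[].
Qed.

Lemma mobiusE x y : x \in T -> y \in T ->
  mobius T x y = if x == y then 1
    else if refines x y then - \sum_(z in below T x y) mobius T x z else 0.
Proof.
move=> xT yT; rewrite -(@mobius_recE #|T|.+1) //; last first.
  apply: leqW; apply: subset_leq_card.
  by apply/subsetP => z; rewrite inE => /andP[].
Qed.

End MobiusFacts.

From mathcomp Require Import all_classical reals numfun.

Local Open Scope classical_set_scope.
Local Open Scope ring_scope.

Section Measures.
Variable R : realType.

(* A signed measure is a real-valued function of arbitrary subsets; the Dirac
   measure at x sends A to \1_A x. *)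
Definition discrete_smeasure (U : Type) (eta : set U -> R) : Prop :=
  exists s : seq (R * U), forall A, eta A = \sum_(c <- s) c.1 * \1_A c.2.

Definition discrete_probability (U : Type) (P : set U -> R) : Prop :=
  [/\ discrete_smeasure P, forall A, 0 <= P A & P setT = 1].

Section Products.
Variables (n : nat) (Y : 'I_n -> Type).

Definition subprod (F : {set 'I_n}) : Type :=
  forall i : {i : 'I_n | i \in F}, Y (val i).

Definition restr (F : {set 'I_n}) (y : forall i, Y i) : subprod F :=
  fun i => y (val i).

Definition marginal (F : {set 'I_n}) (P : set (forall i, Y i) -> R) :
  set (subprod F) -> R := fun B => P (@restr F @^-1` B).

(* The product of discrete measures Q_F, F a block of p, as a measure on the
   product of all the Y i: the mass of the point y is the product of the
   Q_F-masses of its restrictions.  Only finitely many points have nonzero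
   mass, so that the sum over the points of A is a finite one. *)
Definition prod_smeasure (p : setpart n)
    (Q : forall F : {set 'I_n}, set (subprod F) -> R) :
  set (forall i, Y i) -> R :=
  fun A => \sum_(y \in (A : set {classic (forall i, Y i)}))
             \prod_(F in p) Q F [set @restr F y].

Definition part_smeasure (P : set (forall i, Y i) -> R) (p : setpart n) :
  set (forall i, Y i) -> R := prod_smeasure p (fun F => @marginal F P).

Definition interaction (T : {set setpart n}) (P : set (forall i, Y i) -> R) :
  set (forall i, Y i) -> R :=
  fun A => \sum_(p in T) (mobius T p (one_part n))%:~R * part_smeasure P p A.

(* The pushforward of eta under the coordinate permutation
   (x_i)_i |-> (x_(tau i))_i; see [perm_smeasure_rect]. *)
Definition perm_smeasure (tau : 'S_n) (eta : set (forall i, Y i) -> R) :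
  set (forall i, Y (tau i)) -> R :=
  fun B => eta ((fun x i => x (tau i)) @^-1` B).

End Products.
End Measures.

Arguments perm_smeasure {R n Y} tau eta B.
Arguments prod_smeasure {R n Y} p Q A.

Section ProductFacts.
Variables (R : realType) (n : nat) (Y : 'I_n -> Type).

Lemma perm_smeasure_rect (tau : 'S_n) (eta : set (forall i, Y i) -> R)
    (A : forall i, set (Y i)) :
  perm_smeasure tau eta [set y | forall i, A (tau i) (y i)] =
  eta [set x | forall i, A i (x i)].
Proof.
congr (eta _); apply/seteqP; split=> x /= xA i; last exact: xA.
by have := xA ((tau^-1)%g i); rewrite permKV.
Qed.

Lemma fsum_points (I : finType) (U : choiceType) (C : I -> R) (g : I -> U)
    (A : set U) :
  \sum_(y \in A) \sum_(f : I) C f * \1_[set g f] y =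
  \sum_(f : I) C f * \1_A (g f).
Proof.
rewrite -[A in LHS]set_mem_set -(@bigfs _ _ _ _ (undup [seq g f | f <- enum I])) ?undup_uniq //=; last first.
  move=> y Ay; rewrite mem_undup => ny; apply: big1 => f _.
  rewrite indicE; case: (boolP (y \in _)) => [|_]; last by rewrite mulr0.
  rewrite inE /= => yf; case/negP: ny; rewrite yf; apply/mapP; exists f => //.
  by rewrite mem_enum.
rewrite exchange_big /=; apply: eq_bigr => f _.
rewrite -big_distrr /=; congr (_ * _).
rewrite (bigID (pred1 (g f))) /= [X in _ + X]big1 ?addr0; last first.
  move=> y /andP[_ nyf]; rewrite indicE; case: (boolP (y \in _)) => //.
  by rewrite inE /= => yf; rewrite yf eqxx in nyf.
rewrite big_mkcondl /= -big_filter filter_pred1_uniq ?undup_uniq //; last first.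
  by rewrite mem_undup; apply/mapP; exists f; rewrite ?mem_enum.
rewrite big_seq1 !indicE.
have -> : g f \in [set g f] by rewrite inE.
have -> : in_set A (g f) = (g f \in A) by [].
by case: (g f \in A).
Qed.

Lemma discrete_smeasure_nth (U : Type) (eta : set U -> R) (u0 : U) :
  discrete_smeasure eta -> exists (N : nat) (c : nat -> R) (x : nat -> U),
    forall M A, (N <= M)%N -> eta A = \sum_(k < M) c k * \1_A (x k).
Proof.
move=> [s hs]; exists (size s), (fun k => (nth (0, u0) s k).1),
  (fun k => (nth (0, u0) s k).2) => M A sM.
rewrite hs (big_nth (0, u0)) big_mkord.
rewrite (big_ord_widen _ (fun k => (nth (0, u0) s k).1 *
  \1_A (nth (0, u0) s k).2) sM) big_mkcond; apply: eq_bigr => k _.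
by case: ltnP => // sk; rewrite nth_default //= mul0r.
Qed.

Variables (p : setpart n) (pP : p \in Pi n).
Variable Q : forall F : {set 'I_n}, set (@subprod n Y F) -> R.
Hypothesis dQ : forall F, F \in p -> discrete_smeasure (@Q F).

Let J := {F : {set 'I_n} | F \in p}.

Let blk_ex i : {j : J | i \in val j}.
Proof.
have [pi ipi] := part_block pP i.
by exists (exist _ (finset.pblock p i) pi).
Qed.

Let glue (h : forall j : J, @subprod n Y (val j)) : forall i, Y i :=
  fun i => h (sval (blk_ex i)) (exist _ i (proj2_sig (blk_ex i))).

Let restr_glue h (j : J) : restr (glue h) = h j :> @subprod n Y (val j).
Proof.
apply: functional_extensionality_dep => -[i ij]; rewrite /restr /glue /=.
case: (blk_ex i) => j' ij' /=.
have jj : j' = j.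
  by apply: val_inj; apply: (part_block_uniq pP (valP j') (valP j) ij' ij).
by subst j'; rewrite (bool_irrelevance ij' ij).
Qed.

Let prodJ (g : {set 'I_n} -> R) : \prod_(F in p) g F = \prod_(j : J) g (val j).
Proof. by rewrite big_sub. Qed.

(* The product of discrete measures is a discrete measure, and it has the
   product values on rectangles. *)
Lemma prod_smeasureP : discrete_smeasure (prod_smeasure p Q) /\
  forall B : forall F : {set 'I_n}, set (@subprod n Y F),
    prod_smeasure p Q [set y | forall F, F \in p -> B F (restr y)] =
    \prod_(F in p) Q (B F).
Proof.
have [h0|nh] := pselect (exists h : forall j : J, @subprod n Y (val j), True);
    last first.
  have [F Fp Q0] : exists2 F, F \in p & forall A, @Q F A = 0.
    apply: contrapT => no; apply: nh.
    suff /choice H : forall j : J, exists u : {j : J & @subprod n Y (val j)}, projT1 u = j.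
      case: H => f fE; exists (fun j => eq_rect _ (fun j => @subprod n Y (val j)) (projT2 (f j)) _ (fE j)) => //.
    move=> j; apply: contrapT => nj; apply: no; exists (val j) => [|A]; first exact: valP.
    have [s ->] := dQ (valP j); case: s => [|c s]; first by rewrite big_nil.
    by case: nj; exists (existT _ j c.2).
  have P0 A : prod_smeasure p Q A = 0.
    by apply: fsbig1 => y _; rewrite (bigD1 F) //= Q0 mul0r.
  split; first by exists [::] => A; rewrite big_nil P0.
  by move=> B; rewrite P0 (bigD1 F) //= Q0 mul0r.
case: h0 => h0 _.
have /choice[N /choice[c]] : forall j : J, exists N, exists c : (nat -> R) , exists (x : nat -> subprod Y (val j)),
   forall M A, (N <= M)%N -> @Q (val j) A = \sum_(k < M) c k * \1_A (x k).
  by move=> j; apply: discrete_smeasure_nth (h0 j) (dQ (valP j)).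
move=> hx.
have [x {}hx] : exists x : forall j : J, nat -> subprod Y (val j), forall j M A,
    (N j <= M)%N -> @Q (val j) A = \sum_(k < M) c j k * \1_A (x j k).
  by exists (fun j => sval (cid (hx j))) => j; exact: (svalP (cid (hx j))).
pose M := \max_j N j.
have QE (j : J) A : @Q (val j) A = \sum_(k < M) c j k * \1_A (x j k).
  by apply: hx; apply: leq_bigmax.
pose g (f : {ffun J -> 'I_M}) := glue (fun j => x j (f j)).
pose C (f : {ffun J -> 'I_M}) := \prod_j c j (f j).
have prodE (B : forall F : {set 'I_n}, set (@subprod n Y F)) :
    \prod_(F in p) Q (B F) =
    \sum_f C f * \1_[set y | forall F, F \in p -> B F (restr y)] (g f).
  rewrite (prodJ (fun F => Q (B F))); under eq_bigr do rewrite QE.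
  rewrite bigA_distr_bigA /=; apply: eq_bigr => f _.
  rewrite big_split /=; congr (_ * _).
  rewrite indicE; case: (boolP (_ \in _)).
    rewrite inE /= => h; apply: big1 => j _; rewrite indicE mem_set //.
    by rewrite -(restr_glue (fun j => x j (f j)) j); apply: h; apply: valP.
  rewrite notin_setE /= => h; apply/eqP; rewrite prodf_seq_eq0; apply/hasP.
  apply: contrapT => no; apply: h => F Fp.
  have := restr_glue (fun j => x j (f j)) (exist _ F Fp); rewrite /= => ->.
  apply: contrapT => nB; apply: no; exists (exist _ F Fp); first by rewrite mem_index_enum.
  by rewrite /= indicE memNset.
have sumE A : prod_smeasure p Q A = \sum_f C f * \1_A (g f).
  rewrite -(@fsum_points _ {classic (forall i, Y i)}); apply: eq_fsbigr => y _.
  rewrite (prodE (fun F => [set restr y])); apply: eq_bigr => f _; congr (_ * _).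
  rewrite !indicE; congr ((nat_of_bool _)%:R).
  apply/idP/idP; rewrite !inE /=; last by move=> ->.
  move=> h; apply: functional_extensionality_dep => i; apply/esym.
  have [j ij] := blk_ex i; have := h _ (valP j) => /(congr1 (fun u => u (exist _ i ij))).
  exact.
split; last by move=> B; rewrite sumE prodE.
exists [seq (C f, g f) | f <- index_enum {ffun J -> 'I_M}] => A.
by rewrite big_map sumE.
Qed.

End ProductFacts.

Section PartFacts.
Variables (R : realType) (n : nat) (Y : 'I_n -> Type).
Variable P : set (forall i, Y i) -> R.
Hypothesis dP : discrete_smeasure P.

Lemma marginal_discrete F : discrete_smeasure (marginal (F := F) P).
Proof.
have [s hs] := dP; exists [seq (c.1, restr c.2) | c <- s] => A.
by rewrite /marginal hs big_map.
Qed.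

Lemma part_smeasure_discrete (p : setpart n) :
  p \in Pi n -> discrete_smeasure (part_smeasure P p).
Proof.
move=> pP; apply: (@prod_smeasureP _ _ _ p pP (fun F => marginal (F := F) P) _).1.
by move=> F _; exact: marginal_discrete.
Qed.

Lemma part_smeasure_rect (p : setpart n) (B : forall F, set (subprod Y F)) :
  p \in Pi n ->
  part_smeasure P p [set y | forall F, F \in p -> B F (restr y)] =
  \prod_(F in p) P [set y | B F (restr y)].
Proof.
move=> pP; apply: (@prod_smeasureP _ _ _ p pP (fun F => marginal (F := F) P) _).2.
by move=> F _; exact: marginal_discrete.
Qed.

End PartFacts.

(* Main.v *)
Require Import Defs.
From HB Require Import structures.
From mathcomp Require Import all_boot all_order all_algebra.
From mathcomp Require Import perm.
From mathcomp Require Import all_classical reals numfun.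

(** The marginal products transform by [(P^tau)_p = (P_(tau p))^tau], so that
    both sides of the equation [T[P^tau] = (T[P])^tau] are combinations of the
    same measures [P_p], [p] ranging over all partitions: the coefficient of
    [P_p] is [mobius T p 1] on the right and [mobius T (tau^-1 p) 1] on the left,
    read as 0 outside [T] ([interaction_coef], [interaction_perm]).

    If [T] is invariant, relabelling by [tau] is an automorphism of the poset
    [T], hence preserves its Moebius function, and the coefficients agree.

    Conversely, one measure [P] suffices to compare coefficients.  Choose [n]
    distinct points in every factor and let [P] be uniform on the [n] diagonal
    points of the resulting grid.  For a partition [q], let [y_q] be a grid point
    with equal labels exactly inside the blocks of [q].  A block [F] contributes
    a nonzero factor to the [P_p]-mass of [y_q] iff [y_q] has a constant label on
    [F]; so that mass is nonzero iff [p] refines [q].  The masses thus form a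
    triangular system with nonzero diagonal, and the [P_p] are linearly
    independent ([part_smeasure_diagonal_free]).  Therefore the coefficients are
    invariant under [tau].  If [m] is maximal among the elements of [T] other than
    the one-block partition, its coefficient is [-1], whence [tau m] lies in [T].
    Every [p] in [T] but the one-block partition is below such an [m], and
    [tau p] lies in [T] because it is below [tau m] and [T] is a lower set. *)

Set Implicit Arguments.
Unset Strict Implicit.
Unset Printing Implicit Defensive.

Import Order.TTheory GRing.Theory Num.Theory.

Local Open Scope classical_set_scope.
Local Open Scope card_scope.

(** * The refinement order *)

Section Refinement.
Variable n : nat.
Implicit Types (p q r : setpart n) (tau : 'S_n).

Lemma refines_one_part p : refines p (one_part n).
Proof.
by apply/refinesP => B _; exists [set: 'I_n]%SET; rewrite ?inE ?finset.subsetT.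
Qed.

(** Turns the refinement order into an induction measure. *)
Lemma refines_card_lt p q : p \in Pi n -> q \in Pi n ->
  refines p q -> p != q ->
  (#|[set r in Pi n | refines r p]%SET| < #|[set r in Pi n | refines r q]%SET|)%N.
Proof.
move=> pP qP pq npq; apply: proper_card; apply/properP; split.
  by apply/fintype.subsetP => r; rewrite !inE => /andP[-> /refines_trans]; exact.
exists q; first by rewrite inE qP refines_refl.
rewrite inE qP /=; apply: contra npq => qp.
by apply/eqP; exact: refines_anti.
Qed.

Lemma block_neq0 p (F : {set 'I_n}) : p \in Pi n -> F \in p -> F != finset.set0.
Proof. by rewrite inE => /and3P[_ _ p0] Fp; apply: contraNneq p0 => <-. Qed.

(** A representative of the block of [i]: a function constant on each block of
    [p] that separates the blocks. *)
Definition part_label p (i : 'I_n) : 'I_n :=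
  odflt i [pick j in finset.pblock p i].

Lemma part_label_mem p i : p \in Pi n -> part_label p i \in finset.pblock p i.
Proof.
move=> pP; rewrite /part_label; case: pickP => //= _.
by have [] := part_block pP i.
Qed.

Lemma eq_part_label p (F : {set 'I_n}) i j : p \in Pi n -> F \in p -> i \in F ->
  (part_label p i == part_label p j) = (j \in F).
Proof.
move=> pP Fp iF; have [ip ii] := part_block pP i; have [jp jj] := part_block pP j.
have -> : F = finset.pblock p i by apply: (part_block_uniq pP _ _ iF ii).
apply/eqP/idP => [e|ji].
  suff -> : finset.pblock p i = finset.pblock p j by [].
  apply: (part_block_uniq pP _ _ (part_label_mem i pP)) => //.
  by rewrite e part_label_mem.
have e : finset.pblock p i = finset.pblock p j by apply: (part_block_uniq pP _ _ ji jj).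
rewrite /part_label -e; case: pickP => // none.
by have := none i; rewrite ii.
Qed.

Lemma refines_label p q : p \in Pi n -> q \in Pi n ->
  refines p q = [forall F in p,
    [forall i in F, [forall j in F, part_label q i == part_label q j]]].
Proof.
move=> pP qP; apply/refinesP/forall_inP => [pq F Fp | h F Fp].
  have [G Gq FG] := pq F Fp.
  apply/forall_inP => i iF; apply/forall_inP => j jF.
  by rewrite (eq_part_label j qP Gq) (fintype.subsetP FG).
have [i iF] : exists i, i \in F.
  by apply/set0Pn; exact: block_neq0 Fp.
have [Gq iG] := part_block qP i; exists (finset.pblock q i) => //.
apply/fintype.subsetP => j jF; rewrite -(eq_part_label j qP Gq iG).
by move/forall_inP/(_ i iF)/forall_inP/(_ j jF): (h F Fp).
Qed.

(** * Relabelling partitions *)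

Lemma perm_part_inj tau : injective (perm_part tau).
Proof. by apply: imset_inj; apply: imset_inj; exact: perm_inj. Qed.

Lemma perm_partK tau : cancel (perm_part tau) (perm_part tau^-1%g).
Proof.
move=> p; rewrite /perm_part -imset_comp -[RHS]imset_id; apply: eq_imset => F /=.
rewrite -imset_comp -[RHS]imset_id; apply: eq_imset => i /=.
by rewrite permK.
Qed.

Lemma perm_partKV tau : cancel (perm_part tau^-1%g) (perm_part tau).
Proof. by move=> p; rewrite -{1}[tau]invgK perm_partK. Qed.

Lemma perm_part_refines tau p q :
  refines p q -> refines (perm_part tau p) (perm_part tau q).
Proof.
move=> /refinesP pq; apply/refinesP => _ /imsetP[F /pq[G Gq FG] ->].
by exists [set tau x | x in G]%SET; [exact: imset_f | exact: imsetS].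
Qed.

Lemma refines_perm_part tau p q :
  refines (perm_part tau p) (perm_part tau q) = refines p q.
Proof.
apply/idP/idP; last exact: perm_part_refines.
by move=> /(perm_part_refines tau^-1%g); rewrite !perm_partK.
Qed.

Lemma imset_perm_setT tau : [set tau x | x in [set: 'I_n]]%SET = [set: 'I_n]%SET.
Proof.
apply/setP => i; rewrite !inE; apply/imsetP; exists (tau^-1%g i) => //.
by rewrite permKV.
Qed.

Lemma perm_part_one tau : perm_part tau (one_part n) = one_part n.
Proof. by rewrite /perm_part imset_set1 imset_perm_setT. Qed.

Lemma perm_part_eq_one tau p :
  (perm_part tau p == one_part n) = (p == one_part n).
Proof. by rewrite -{1}(perm_part_one tau) (inj_eq (@perm_part_inj tau)). Qed.

Lemma perm_part_Pi tau p : p \in Pi n -> perm_part tau p \in Pi n.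
Proof.
move=> pP; rewrite inE; apply/and3P; split.
- rewrite finset.eqEsubset finset.subsetT; apply/fintype.subsetP => i _.
  have [bp ib] := part_block pP (tau^-1%g i).
  apply/bigcupP; exists [set tau x | x in finset.pblock p (tau^-1%g i)]%SET.
    exact: imset_f.
  by apply/imsetP; exists (tau^-1%g i); rewrite ?permKV.
- apply/finset.trivIsetP => _ _ /imsetP[F Fp ->] /imsetP[G Gp ->] nFG.
  apply/pred0P => i /=; apply: contraNF nFG.
  move=> /andP[/imsetP[j jF ->] /imsetP[k kG /perm_inj jk]].
  by rewrite (part_block_uniq pP Fp Gp jF) // jk.
- apply/imsetP => -[F Fp /esym/eqP]; rewrite imset_eq0.
  by apply/negP; exact: block_neq0 Fp.
Qed.

Section MobiusPermutation.
Variables (T : {set setpart n}) (symT : sym_invariant T).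

Lemma perm_part_invariant tau p : (perm_part tau p \in T) = (p \in T).
Proof.
apply/idP/idP => [/symT/(_ tau^-1%g)|/symT]; last exact.
by rewrite perm_partK.
Qed.

Lemma mobius_perm_part tau p q :
  mobius T (perm_part tau p) (perm_part tau q) = mobius T p q.
Proof.
rewrite /mobius; elim: #|T| p q => //= k IH p q.
rewrite (inj_eq (@perm_part_inj tau)) refines_perm_part.
do 2!case: ifP => // _; congr (- _)%R.
rewrite (reindex_onto (perm_part tau) (perm_part tau^-1%g)) /=; last first.
  by move=> r _; rewrite perm_partKV.
apply: eq_big => [r|r _]; last exact: IH.
by rewrite perm_partK eqxx andbT !inE perm_part_invariant !refines_perm_part
  (inj_eq (@perm_part_inj tau)).
Qed.

End MobiusPermutation.

(** Only [m] itself lies strictly below the top in the interval from [m]. *)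
Lemma mobius_coatom (T : {set setpart n}) m : T \subset Pi n ->
  one_part n \in T -> m \in T -> m != one_part n ->
  (forall z, z \in T -> refines m z -> z != one_part n -> z = m) ->
  mobius T m (one_part n) = (-1)%R.
Proof.
move=> TPi oneT mT m1 mmax.
rewrite mobiusE // (negbTE m1) refines_one_part.
have -> : below T m (one_part n) = [set m]%SET.
  apply/setP => z; rewrite !inE refines_one_part /=; apply/idP/eqP.
    by move=> /and3P[zT mz z1]; exact: mmax.
  by move=> ->; rewrite mT refines_refl.
by rewrite big_set1 mobiusE // eqxx.
Qed.

Lemma coatom_above (T : {set setpart n}) p : T \subset Pi n -> p \in T ->
  p != one_part n ->
  exists m, [/\ m \in T, m != one_part n, refines p m &
    forall z, z \in T -> refines m z -> z != one_part n -> z = m].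
Proof.
move=> /fintype.subsetP TPi pT p1.
have p0 : [&& p \in T, p != one_part n & refines p p].
  by rewrite pT p1 refines_refl.
(* A candidate with the most refinements is maximal by [refines_card_lt]. *)
case: (arg_maxnP (P := fun z => [&& z \in T, z != one_part n & refines p z])
  (fun z => #|[set r in Pi n | refines r z]%SET|) p0).
move=> m /and3P[mT m1 pm] mmax.
exists m; split=> // z zT mz z1; apply/eqP; apply/contraT; rewrite eq_sym => nmz.
have := refines_card_lt (TPi _ mT) (TPi _ zT) mz nmz.
rewrite ltnNge => /negP[]; apply: mmax.
by rewrite zT z1 (refines_trans pm mz).
Qed.

End Refinement.

(** * Permuting coordinates *)

Section Permutation.
Local Open Scope ring_scope.
Variables (R : realType) (n : nat) (Y : 'I_n -> Type) (tau : 'S_n).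

Definition perm_point (x : forall i, Y i) : forall i, Y (tau i) :=
  fun i => x (tau i).

Lemma perm_point_inj : injective perm_point.
Proof.
move=> x y /= xy; apply: functional_extensionality_dep => i.
have /(congr1 (fun u => u (tau^-1%g i))) := xy.
by rewrite /perm_point permKV.
Qed.

Lemma perm_point_surj y : exists x, perm_point x = y.
Proof.
(* Coordinate [tau^-1 i] of [y] lives in [Y (tau (tau^-1 i))], not in [Y i]. *)
exists (fun i => eq_rect _ Y (y (tau^-1%g i)) _ (permKV tau i)).
apply: functional_extensionality_dep => i; rewrite /perm_point.
move: (permKV tau (tau i)); rewrite permK => e.
by rewrite (Prop_irrelevance e erefl).
Qed.

Lemma restr_perm_point (F : {set 'I_n}) x y :
  restr (F := F) (perm_point x) = restr (F := F) (perm_point y) <->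
  restr (F := [set tau i | i in F]%SET) x =
    restr (F := [set tau i | i in F]%SET) y.
Proof.
split=> h; apply: functional_extensionality_dep => -[i iF]; rewrite /restr /=.
  have [j jF ij] := imsetP iF; rewrite ij.
  exact: (congr1 (fun u => u (exist _ j jF)) h).
exact: (congr1 (fun u => u (exist _ (tau i) (imset_f tau iF))) h).
Qed.

(** Two permuted points agree on [F] iff the original ones agree on [tau F], so
    the factors of the point masses match; permuting coordinates is a bijection
    on points, so the sums of these masses match as well. *)
Lemma part_smeasure_perm (P : set (forall i, Y i) -> R) (p : setpart n) :
  part_smeasure (Y := fun i => Y (tau i)) (perm_smeasure tau P) p =
  perm_smeasure tau (part_smeasure P (perm_part tau p)).
Proof.
apply/funext => B; rewrite /perm_smeasure /part_smeasure /prod_smeasure.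
have bij : set_bij (perm_point @^-1` B : set {classic (forall i, Y i)})
    (B : set {classic (forall i, Y (tau i))}) perm_point.
  split=> [x //|x y _ _ /perm_point_inj //|y By].
  by have [x xy] := perm_point_surj y; exists x => //=; rewrite xy.
rewrite (reindex_fsbig _ _ _ _ bij); apply: eq_fsbigr => x _.
rewrite big_imset /=; last by move=> ? ? _ _; apply: imset_inj; exact: perm_inj.
apply: eq_bigr => F _; rewrite /marginal; congr (P _).
by apply/seteqP; split=> z /= /restr_perm_point.
Qed.

End Permutation.

Section Coefficients.
Local Open Scope ring_scope.
Variables (R : realType) (n : nat) (Y : 'I_n -> Type) (T : {set setpart n}).
Hypothesis TPi : T \subset Pi n.

(** Extended by 0 outside [T], so that sums over [T] become sums over all
    partitions, where [T] and its image under a permutation can be compared. *)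
Definition mobius_coef (p : setpart n) : R :=
  if p \in T then (mobius T p (one_part n))%:~R else 0.

Lemma interaction_coef (P : set (forall i, Y i) -> R) A :
  interaction T P A = \sum_(p in Pi n) mobius_coef p * part_smeasure P p A.
Proof.
rewrite /interaction [RHS](big_setID T) /= (finset.setIidPr TPi).
rewrite [X in _ + X]big1 ?addr0 => [|p].
  by apply: eq_bigr => p pT; rewrite /mobius_coef pT.
by rewrite inE => /andP[/negbTE pT _]; rewrite /mobius_coef pT mul0r.
Qed.

End Coefficients.

Lemma interaction_perm (R : realType) n (Y : 'I_n -> Type) (tau : 'S_n)
    (T : {set setpart n}) (P : set (forall i, Y i) -> R) B : T \subset Pi n ->
  (interaction (Y := fun i => Y (tau i)) T (perm_smeasure tau P) B =
   \sum_(p in Pi n) mobius_coef R T (perm_part tau^-1%g p) *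
     part_smeasure P p (@perm_point n Y tau @^-1` B))%R.
Proof.
move=> TPi; rewrite interaction_coef //.
rewrite [RHS](reindex_onto (perm_part tau) (perm_part tau^-1%g)) /=; last first.
  by move=> p _; rewrite perm_partKV.
apply: eq_big => [p|p _]; last by rewrite perm_partK part_smeasure_perm.
rewrite perm_partK eqxx andbT; apply/idP/idP => [|/(perm_part_Pi tau^-1%g)].
  exact: perm_part_Pi.
by rewrite perm_partK.
Qed.

(** * The diagonal measure *)

Lemma card_le_injective n (U : Type) : `I_n #<= [set: U] ->
  exists f : 'I_n -> U, injective f.
Proof.
move=> /card_leP[f].
have im (k : 'I_n) : (k : nat) \in `I_n by rewrite inE /= ltn_ord.
exists (fun k => \val (f (SigSub (im k)))) => k l e.
have /(@inj _ _ _ f) : f (SigSub (im k)) = f (SigSub (im l)) by exact: val_inj.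
by rewrite !inE => /(_ I I) /(congr1 \val) /= /val_inj.
Qed.

Section Diagonal.
Local Open Scope ring_scope.
Variables (R : realType) (n : nat) (X : 'I_n -> Type).
Variable d : forall i, 'I_n -> X i.
Hypotheses (d_inj : forall i, injective (@d i)) (n_gt0 : (0 < n)%N).

Definition diagonal (A : set (forall i, X i)) : R :=
  \sum_(k < n) n%:R^-1 * \1_A (fun i => d i k).

Lemma diagonal_probability : discrete_probability diagonal.
Proof.
split.
- exists [seq (n%:R^-1, fun i => d i k) | k <- index_enum 'I_n] => A.
  by rewrite big_map.
- by move=> A; apply: sumr_ge0 => k _; rewrite mulr_ge0 ?invr_ge0.
- rewrite /diagonal; under eq_bigr do rewrite indicT mulr1.
  by rewrite sumr_const card_ord -[_ *+ _]mulr_natl divff // pnatr_eq0 -lt0n.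
Qed.

(** The [k]-th diagonal point agrees with the grid point [(d i (c i))_i] on [F]
    iff [c] is equal to [k] on [F]. *)
Lemma marginal_diagonal_eq0 (F : {set 'I_n}) (c : 'I_n -> 'I_n) :
  F != finset.set0 ->
  (marginal (F := F) diagonal [set restr (fun i => d i (c i))] == 0) =
  ~~ [forall i in F, [forall j in F, c i == c j]].
Proof.
move=> /set0Pn[i0 i0F].
rewrite /marginal /diagonal psumr_eq0; last first.
  by move=> k _; rewrite mulr_ge0 ?invr_ge0.
have ninv : n%:R^-1 != 0 :> R by rewrite invr_eq0 pnatr_eq0 -lt0n.
apply/idP/idP.
  apply: contraL => cF; apply/allPn; exists (c i0); first by rewrite mem_index_enum.
  rewrite /= mulf_eq0 negb_or ninv indicE mem_set ?oner_eq0 //=.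
  apply: functional_extensionality_dep => -[i iF]; rewrite /restr /=.
  by move/forall_inP/(_ i0 i0F)/forall_inP/(_ i iF)/eqP: cF => ->.
apply: contraNT => /allPn[k _ /=]; rewrite mulf_eq0 negb_or indicE => /andP[_].
case: (boolP (_ \in _)); last by rewrite eqxx.
rewrite inE => /= h _.
have ck i : i \in F -> c i = k.
  move=> iF; apply: (@d_inj i); apply/esym.
  exact: (congr1 (fun u => u (exist _ i iF)) h).
by apply/forall_inP => i iF; apply/forall_inP => j jF; rewrite !ck.
Qed.

Lemma part_smeasure_diagonal_eq0 (p q : setpart n) : p \in Pi n -> q \in Pi n ->
  (part_smeasure diagonal p [set fun i => d i (part_label q i)] == 0) =
  ~~ refines p q.
Proof.
move=> pP qP; rewrite /part_smeasure /prod_smeasure.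
rewrite (@fsbig_set1 _ _ _ {classic (forall i, X i)}).
rewrite refines_label // negb_forall_in.
apply/prodf_eq0/exists_inP => -[F Fp h]; exists F => //.
  by rewrite -marginal_diagonal_eq0 ?(block_neq0 pP).
by rewrite marginal_diagonal_eq0 ?(block_neq0 pP).
Qed.

(** Evaluated at the label point of [q], the sum retains only the refinements of
    [q]; by induction along the order only the term of [q] itself is left. *)
Lemma part_smeasure_diagonal_free (a : setpart n -> R) :
  (forall y, \sum_(p in Pi n) a p * part_smeasure diagonal p [set y] = 0) ->
  forall p, p \in Pi n -> a p = 0.
Proof.
move=> a0 q; have [m] := ubnP #|[set r in Pi n | refines r q]%SET|.
elim: m q => // m IH q; rewrite ltnS => qm qP.
have := a0 (fun i => d i (part_label q i)).
rewrite (bigD1 q) //= big1 ?addr0 => [/eqP|p /andP[pP npq]].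
  by rewrite mulf_eq0 part_smeasure_diagonal_eq0 // refines_refl orbF => /eqP.
have [pq|npq'] := boolP (refines p q).
  by rewrite IH ?mul0r //; apply: leq_trans qm; exact: refines_card_lt.
by apply/eqP; rewrite mulf_eq0 part_smeasure_diagonal_eq0 // npq' orbT.
Qed.

End Diagonal.

(** * Equivariance and invariance *)

Theorem theorem3p12 (R : realType) (n : nat) (X : 'I_n -> Type)
    (T : {set setpart n})
    (hT : lower_set T) (hX : forall i : 'I_n, `I_n #<= [set: X i]) :
  sym_invariant T <->
  (forall (tau : 'S_n) (P : set (forall i, X i) -> R),
     discrete_probability P ->
     interaction (Y := fun i => X (tau i)) T (perm_smeasure tau P) =
     perm_smeasure tau (interaction T P)).
Proof.
have [TPi _ oneT down] := hT.
have TP p : p \in T -> p \in Pi n by apply/fintype.subsetP.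
split=> [symT tau P _|equi p pT tau].
  apply/funext => B.
  rewrite interaction_perm // /perm_smeasure interaction_coef //.
  apply: eq_bigr => p _; rewrite /mobius_coef perm_part_invariant //.
  by rewrite -{1}(perm_part_one tau^-1%g) mobius_perm_part.
have n_gt0 : (0 < n)%N.
  rewrite lt0n; apply/eqP => n0.
  have /set0Pn[i _] := block_neq0 (TP _ oneT) (set11 [set: 'I_n]%SET).
  by have := ltn_ord i; rewrite {2}n0.
have [d d_inj] : exists d : forall i, 'I_n -> X i, forall i, injective (d i).
  pose f i := cid (card_le_injective (hX i)).
  by exists (fun i => sval (f i)) => i; exact: (svalP (f i)).
have coef_inv q : q \in Pi n ->
    mobius_coef R T (perm_part tau^-1%g q) = mobius_coef R T q.
  move=> qP; apply/eqP; rewrite -subr_eq0; apply/eqP; move: q qP.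
  apply: (part_smeasure_diagonal_free d_inj n_gt0) => y.
  (* The image of [y] has the single preimage [y], coordinate permutations being
     injective. *)
  have := congr1 (fun f => f (@perm_point n X tau @` [set y]))
    (equi tau _ (diagonal_probability R d n_gt0)).
  rewrite interaction_perm // /perm_smeasure interaction_coef //.
  have -> : @perm_point n X tau @^-1` (@perm_point n X tau @` [set y]) = [set y].
    by apply/seteqP; split=> [x /= [_ -> /perm_point_inj ->//]|x /= ->]; exists y.
  move=> e; under eq_bigr do rewrite mulrBl.
  by rewrite sumrB e subrr.
have [->|p1] := eqVneq p (one_part n); first by rewrite perm_part_one.
have [m [mT m1 pm mmax]] := coatom_above TPi pT p1.
suff mtauT : perm_part tau m \in T.
  apply: down mtauT _ _ _; first by rewrite perm_part_eq_one.
    exact/perm_part_Pi/TP.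
  exact: perm_part_refines.
have := coef_inv _ (perm_part_Pi tau (TP _ mT)).
rewrite /mobius_coef perm_partK mT mobius_coatom //.
by case: ifP => // _ /eqP; rewrite intr_eq0.
Qed.
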